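(* Let $L$ be a simple Leibniz algebra over a field $F$ of zero characteristic, and let $L=G\dot{+}I$ be its decomposition as a semidirect sum of a simple Lie subalgebra $G$ and the ideal $I$ generated by squares. Then any derivation $d$ of $L$ can be represented as $d=R_a+\alpha+\triangle$, where $a\in G$, $\alpha: I\to I$, $\triangle: G\to I$, and $\alpha([x,y])=[\alpha(x),y]$ for all $x,y\in L$. Moreover, $\alpha$ is either zero or $\alpha(I)=I$.
   Context: A (right) Leibniz algebra over a field $F$ is an algebra $(L,[\cdot,\cdot])$ over $F$ satisfying $[x,[y,z]]=[[x,y],z]-[[x,z],y]$ for all $x,y,z\in L$. $I$ denotes the ideal of $L$ generated by the squares $[x,x]$, $x\in L$; it coincides with the linear span of the squares, $[L,I]=0$, and $L/I$ is a Lie algebra. $L$ is called simple if its only ideals are $\{0\}$, $I$, $L$ and $[L,L]\neq I$. The decomposition $L=G\dot{+}I$ (a vector space direct sum with $G$ a Lie subalgebra, so $G\cong L/I$) is taken from Barnes's analogue of the Levi-Malcev theorem for Leibniz algebras. A derivation of $L$ is a linear map $d:L\to L$ with $d([x,y])=[d(x),y]+[x,d(y)]$ for all $x,y\in L$. For $a\in L$, $R_a:L\to L$ is the right multiplication operator $R_a(x)=[x,a]$. The linear maps $\alpha: I\to I$ and $\triangle: G\to I$ are regarded as maps on $L$ by setting $\alpha|_G=0$ and $\triangle|_I=0$.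
   Formalization: The algebra L is taken to be finite-dimensional, as in Barnes's Levi-type theorem; without this the claim fails, e.g. for L = G the finitary traceless matrices sl_∞ with I = 0, which has derivations that are not inner. *)

(* Defs.v *)
From HB Require Import structures.
From mathcomp Require Import all_boot all_order all_algebra.

Set Implicit Arguments.
Unset Strict Implicit.
Unset Printing Implicit Defensive.

Import GRing.Theory.
Local Open Scope ring_scope.

(* The algebras are finite dimensional: the carrier L is a vectType, and its
   product is a bilinear map br, with br x y standing for [x, y]. *)
Section LeibnizAlgebra.

Variables (F : fieldType) (L : vectType F) (br : {bilinear L -> L -> L}).
Implicit Types (x y z : L) (U V W Z G I J : {vspace L}).

Definition leibniz : Prop :=
  forall x y z, br x (br y z) = br (br x y) z - br (br x z) y.

Definition rmul (a : L) : 'End(L) := linfun (applyr br a).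

Lemma rmulE a x : rmul a x = br x a.
Proof. by rewrite lfunE. Qed.

Definition derivation (d : 'End(L)) : Prop :=
  forall x y, d (br x y) = br (d x) y + br x (d y).

(* [U, V], the linear span of all products of elements of U and V. *)
Definition brv U V : {vspace L} := <<allpairs br (vbasis U) (vbasis V)>>%VS.

Lemma memv_brv U V x y : x \in U -> y \in V -> br x y \in brv U V.
Proof.
move=> Ux Vy; rewrite (coord_vbasis Ux) (coord_vbasis Vy).
rewrite linear_sumlz memv_suml // => i _.
rewrite linearZl_LR memvZ // linear_sumr memv_suml // => j _.
rewrite linearZr_LR memvZ // memv_span //.
by apply: allpairs_f; rewrite -tnth_nth mem_tnth.
Qed.

Lemma brv_subP U V J :
  reflect (forall x y, x \in U -> y \in V -> br x y \in J) (brv U V <= J)%VS.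
Proof.
apply: (iffP idP) => [sJ x y Ux Vy|H]; first exact/(subvP sJ)/memv_brv.
by apply/span_subvP => _ /allpairsP[[x y] /= [Ux Vy ->]]; apply: H; apply: vbasis_mem.
Qed.

(* J is a two-sided ideal of the subalgebra G (of L itself if G is fullv). *)
Definition ideal_of G J : Prop :=
  (J <= G)%VS /\
  forall x y, x \in J -> y \in G -> br x y \in J /\ br y x \in J.

Definition ideal J : Prop := ideal_of fullv J.

Definition ideal_generated_by (S : L -> Prop) I : Prop :=
  [/\ ideal I, (forall x, S x -> x \in I) &
      forall J, ideal J -> (forall x, S x -> x \in J) -> (I <= J)%VS].

Definition squares_ideal I : Prop :=
  ideal_generated_by (fun z => exists x, z = br x x) I.

Definition simple_leibniz : Prop :=
  leibniz /\
  exists I, [/\ squares_ideal I,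
                (forall J, ideal J -> [\/ J = 0%VS, J = I | J = fullv]) &
                brv fullv fullv <> I].

Definition lie_subalgebra G : Prop :=
  [/\ forall x y, x \in G -> y \in G -> br x y \in G,
      forall x, x \in G -> br x x = 0 &
      forall x y z, x \in G -> y \in G -> z \in G ->
        br (br x y) z + br (br y z) x + br (br z x) y = 0].

Definition simple_lie_subalgebra G : Prop :=
  [/\ lie_subalgebra G, brv G G <> 0%VS &
      forall J, ideal_of G J -> J = 0%VS \/ J = G].

(* f is the extension by zero to L of a linear map U -> W, where Z is the
   chosen complement of U. *)
Definition extends_by_zero U Z W (f : 'End(L)) : Prop :=
  (f @: U <= W)%VS /\ (forall x, x \in Z -> f x = 0).

End LeibnizAlgebra.

(* Main.v *)
(** With [L, I] = 0 and d(I) <= I, the composite of d|_G with the projection onto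
    G is a derivation of the simple Lie algebra G, hence equal to some R_a on G.
    Then h = d - R_a is a derivation of L mapping L into I, and its restrictions
    to I and G are alpha and delta; alpha commutes with right multiplications,
    so alpha(I) is an ideal and simplicity gives the dichotomy.

    Derivations of G are inner because the Killing form is nondegenerate.  Its
    radical is an ideal; if it were all of G, then every ad x would be nilpotent,
    and G would have a nonzero central element by Engel's theorem.  Nilpotency
    is proved over a splitting field of the characteristic polynomial of ad x:
    if f is an additive integer-valued functional on the eigenvalues, the map Y
    acting by f(l) on the generalized eigenspace of l is a derivation, and as
    G = [G, G] a vanishing Killing form forces 0 = tr(Y ad x) = sum_i f(l_i) l_i.
    Applying f gives sum_i f(l_i)^2 = 0, so every f is 0 and so is every l_i. *)

Require Import Defs.
From Stdlib Require Import Classical_Prop.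
From HB Require Import structures.
From mathcomp Require Import all_boot all_order all_algebra fieldext.

Set Implicit Arguments.
Unset Strict Implicit.
Unset Printing Implicit Defensive.

Import GRing.Theory Num.Theory.
Local Open Scope ring_scope.

(** * Splitting fields *)

Lemma irreducible_divisor (F : fieldType) (p : {poly F}) :
  (1 < size p)%N -> exists2 q, irreducible_poly q & q %| p.
Proof.
have [N] := ubnP (size p); elim: N p => // N IHN p /ltnSE le_p_N p_gt1.
(* Irreducibility is not decidable over an arbitrary field, hence the classical case split. *)
have [irr_p | red_p] := classic (irreducible_poly p); first by exists p.
have p0 : p != 0 by rewrite -size_poly_gt0 ltnW.
suff [q [q_neq1 q_dv_p q_neq_p]] :
    exists q : {poly F}, [/\ size q != 1%N, q %| p & ~~ (q %= p)].
  have q0 : q != 0 by apply: contraNneq p0 => q0; rewrite -dvd0p -q0.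
  have q_gt1 : (1 < size q)%N by rewrite ltn_neqAle eq_sym q_neq1 size_poly_gt0.
  have lt_q_p : (size q < size p)%N.
    by rewrite ltn_neqAle dvdp_leq // andbT dvdp_size_eqp.
  have [r irr_r r_dv_q] := IHN q (leq_trans lt_q_p le_p_N) q_gt1.
  by exists r => //; apply: dvdp_trans q_dv_p.
apply: NNPP => no_q; apply: red_p; split=> // q q_neq1 q_dv_p.
by apply/negPn/negP => q_neq_p; apply: no_q; exists q.
Qed.

(** Adjoin a root of an irreducible divisor, split off the linear factor and recurse on the quotient
    over the larger field; the induction therefore quantifies over the field. *)
Lemma splits_in_extension (F : fieldType) (p : {poly F}) : p != 0 ->
  exists (K : fieldType) (iota : {rmorphism F -> K}) (rs : seq K),
    map_poly iota p %= \prod_(r <- rs) ('X - r%:P).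
Proof.
have [N] := ubnP (size p); elim: N F p => // N IHN F p /ltnSE le_p_N p0.
have [p_le1 | p_gt1] := leqP (size p) 1.
  exists F, idfun, [::].
  by rewrite big_nil -size_poly_eq1 map_poly_id // eqn_leq p_le1 size_poly_gt0.
have [q irr_q q_dv_p] := irreducible_divisor p_gt1.
have [L _ [z qz _]] := irredp_FAdjoin irr_q.
have : root (map_poly (in_alg L) p) z.
  by apply: root_dvdp qz; rewrite dvdp_map.
rewrite -dvdp_XsubCl => /dvdpP[s Dp].
have Lp0 : map_poly (in_alg L) p != 0 by rewrite map_poly_eq0.
have s0 : s != 0 by apply: contraNneq Lp0 => s0; rewrite Dp s0 mul0r.
have szp : size p = (size s).+1.
  rewrite -(size_map_poly (in_alg L)) Dp size_mul ?polyXsubC_eq0 //.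
  by rewrite size_XsubC addn2.
have [|K [iota [rs Ds]]] := IHN L s _ s0; first by rewrite -szp.
exists K, (iota \o in_alg L), (iota z :: rs).
rewrite map_poly_comp Dp rmorphM /= rmorphB /= map_polyX map_polyC big_cons.
by rewrite mulrC eqp_mull.
Qed.

(** * Generalized eigenbases *)

Section GeneralizedEigenbasis.

Variables (K : fieldType) (n' : nat).
Local Notation n := n'.+1.
Variables (X : 'M[K]_n) (rs : seq K).
Hypothesis split_X : char_poly X %= \prod_(r <- rs) ('X - r%:P).

(** Kernels of pairwise coprime polynomials in [X] add up to the kernel of their product. Here the
    product is a multiple of the characteristic polynomial, so it annihilates [X]. *)
Lemma sum_geigenspace_split :
  (\sum_(i < size (undup rs)) geigenspace X (undup rs)`_i :=: 1%:M)%MS.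
Proof.
set s := undup rs.
have cop : {in xpredT &, forall i j : 'I_(size s), j != i ->
    coprimep (('X - (s`_i)%:P) ^+ n) (('X - (s`_j)%:P) ^+ n)}.
  move=> i j _ _ ne_ij; rewrite coprimep_expl // coprimep_expr //.
  by rewrite coprimep_XsubC root_XsubC nth_uniq ?undup_uniq // val_eqE.
apply: eqmx_trans (eqmx_sym (kermxpoly_prod X cop)) _.
apply: kermxpoly_min; apply: dvdp_trans (mxminpoly_dvd_char X) _.
have sz_rs : size rs = n.
  have := eqp_size split_X; rewrite size_char_poly size_prod_XsubC.
  by case.
rewrite (eqp_dvdl _ split_X) prodrXl -{}sz_rs.
have : {subset rs <= s} by move=> r; rewrite mem_undup.
(* With [s] generalized to any list containing the roots, each root in turn uses up one factor of
   the power of exponent [size rs]. *)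
move: s {cop} => s; elim: rs => [|r t IHt] sub_rs.
  by rewrite big_nil dvd1p.
rewrite big_cons exprS dvdp_mul ?IHt // => [|x tx]; last first.
  by rewrite sub_rs // inE tx orbT.
have s_r : r \in s by rewrite sub_rs ?mem_head.
have lt_r : (index r s < size s)%N by rewrite index_mem.
by rewrite (bigD1 (Ordinal lt_r)) //= nth_index // dvdp_mulr.
Qed.

(** The rows are built one at a time: [X - l] sends the new row into the span of the earlier ones,
    so [T] grows block triangularly and [l] becomes its new diagonal entry. *)
Lemma generalized_eigenvectors_extend k : (k <= n)%N ->
  exists (B : 'M[K]_(k, n)) (T : 'M[K]_k), [/\ row_free B, B *m X = T *m B
    & forall i, row i B *m (X - (T i i)%:M) ^+ n = 0].
Proof.
elim: k => [_ | k IHk lt_kn].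
  exists 0, 0; split; rewrite ?mulmx0 ?mul0mx //; last by case.
  by rewrite /row_free mxrank0.
have [B [T [freeB BX gB]]] := IHk (ltnW lt_kn).
have [i nBi] : exists i : 'I_(size (undup rs)),
    ~~ (geigenspace X (undup rs)`_i <= B)%MS.
  apply/existsP; rewrite -negb_forall; apply/negP => /forallP sub_B.
  have : (1%:M <= B)%MS by rewrite -sum_geigenspace_split; apply/sumsmx_subP.
  by move/mxrankS; rewrite mxrank1 (eqP freeB) leqNgt lt_kn.
set l := (undup rs)`_i in nBi.
have [j nBj] := row_subPn nBi; set v0 := row j _ in nBj.
pose N := X - l%:M.
have v0N : v0 *m N ^+ n = 0.
  by apply/sub_kermxP; rewrite -geigenspaceE row_sub.
have exm : exists m, (v0 *m N ^+ m <= B)%MS by exists n; rewrite v0N sub0mx.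
(* The last iterate of [v0] under [N] outside the span of [B] is the new row: one more application
   of [N] lands in the span. *)
have [[|m] vm_B min_m] := ex_minnP exm.
  by rewrite expr0 mulmx1 (negPf nBj) in vm_B.
pose v := v0 *m N ^+ m.
have vNB : ~~ (v <= B)%MS by apply/negP => /min_m; rewrite ltnn.
have [c Dc] : exists c, v *m N = c *m B.
  by apply/submxP; rewrite -mulmxA mulmxE -exprSr.
have gv : v *m N ^+ n = 0.
  by rewrite -mulmxA mulmxE -exprD addnC exprD -mulmxE mulmxA v0N mul0mx.
have freeB1 : row_free (col_mx v B).
  apply: inj_row_free => u; rewrite -[u]hsubmxK mul_row_col.
  set a := lsubmx u; set w := rsubmx u; rewrite [a]mx11_scalar mul_scalar_mx.
  have [-> | a0] := eqVneq (a 0 0) 0.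
    rewrite scale0r add0r => /eqP.
    by rewrite mulmx_free_eq0 // => /eqP->; rewrite raddf0 row_mx0.
  move=> /eqP; rewrite addr_eq0 => /eqP av; case/negP: vNB.
  by rewrite -(eqmx_scale _ a0) av -mulNmx submxMl.
have BX1 : col_mx v B *m X = block_mx l%:M c 0 T *m col_mx v B.
  rewrite mul_col_mx mul_block_col mul0mx add0r BX -Dc mulmxBr mul_mx_scalar.
  by rewrite mul_scalar_mx addrC subrK.
have gB1 (i1 : 'I_(1 + k)) :
    row i1 (col_mx v B) *m (X - (block_mx l%:M c 0 T i1 i1)%:M) ^+ n = 0.
  case: (split_ordP i1) => {i1} i1 ->.
    by rewrite block_mxEul rowKu row_id mxE ord1 eqxx mulr1n.
  by rewrite block_mxEdr rowKd.
by exists (col_mx v B), (block_mx l%:M c 0 T).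
Qed.

Lemma generalized_eigenbasis : exists B T : 'M[K]_n,
  [/\ B \in unitmx, B *m X = T *m B
    & forall i, row i B *m (X - (T i i)%:M) ^+ n = 0].
Proof.
have [B [T [freeB BX gB]]] := generalized_eigenvectors_extend (leqnn n).
by exists B, T; rewrite -row_free_unit.
Qed.

End GeneralizedEigenbasis.

(** * Integer relations between eigenvalues *)

Lemma clear_denominators m p (w : 'M[rat]_(m, p)) :
  exists2 d : int, d != 0 &
    exists z : 'M[int]_(m, p), d%:~R *: w = map_mx intr z.
Proof.
exists (\prod_ij denq (w ij.1 ij.2)).
  by apply/prodf_neq0 => ij _; apply: denq_neq0.
exists (\matrix_(i, j)
  (numq (w i j) * \prod_(kl | kl != (i, j)) denq (w kl.1 kl.2))).
apply/matrixP => i j; rewrite !mxE (bigD1 (i, j)) //= !rmorphM /= numqE mulrAC.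
by rewrite [w i j * _]mulrC.
Qed.

Lemma map_intr_mx_inj m p :
  injective (map_mx intr : 'M[int]_(m, p) -> 'M[rat]_(m, p)).
Proof.
move=> M N /matrixP eqMN; apply/matrixP => i j.
by apply: (@intr_inj rat); have := eqMN i j; rewrite !mxE.
Qed.

Section IntegerRelations.

Variables (K : fieldType) (n : nat) (l : 'cV[K]_n).
Hypothesis charK : [pchar K] =i pred0.

Local Notation toQ := (map_mx (intr : int -> rat)).
Local Notation toK := (map_mx (intr : int -> K)).

Lemma intr_eq0_pchar0 (d : int) : (d%:~R == 0 :> K) = (d == 0).
Proof.
have natK (m : nat) : (m%:R == 0 :> K) = (m == 0%N) by have/pcharf0P := charK.
case: d => m; first exact: natK.
by rewrite NegzE rmorphN /= !oppr_eq0 -[_%:~R]/(m.+1%:R) natK.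
Qed.

(** A relation outside the rational span of [M] raises the rank when appended, and the rank is at
    most n; [k] bounds the remaining deficit. *)
Lemma maximal_integer_relations :
  exists m (M : 'M[int]_(m, n)), toK M *m l = 0 /\
    forall c : 'rV[int]_n, toK c *m l = 0 -> (toQ c <= toQ M)%MS.
Proof.
suff max k m (M : 'M[int]_(m, n)) : toK M *m l = 0 ->
    (n <= \rank (toQ M) + k)%N ->
    exists m' (M' : 'M[int]_(m', n)), toK M' *m l = 0 /\
      forall c : 'rV[int]_n, toK c *m l = 0 -> (toQ c <= toQ M')%MS.
  by apply: (max n 0%N 0); rewrite ?leq_addl // map_mx0 mul0mx.
elim: k m M => [|k IHk] m M Ml rkM.
  exists m, M; split=> // c _; apply: submx_full.
  by rewrite addn0 in rkM; rewrite /row_full eqn_leq rank_leq_col.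
have [[c [cl cM]] | maxM] := classic (exists c : 'rV[int]_n,
    toK c *m l = 0 /\ ~~ (toQ c <= toQ M)%MS); last first.
  exists m, M; split=> // c cl; apply/negPn/negP => cM.
  by apply: maxM; exists c.
apply: (IHk _ (col_mx M c)).
  by rewrite map_col_mx mul_col_mx Ml cl col_mx0.
apply: leq_trans rkM _; rewrite addnS -addSn leq_add2r map_col_mx -addsmxE.
rewrite ltn_neqAle mxrankS ?addsmxSl // andbT.
by rewrite (mxrank_leqif_sup (addsmxSl _ _)).2 addsmx_sub submx_refl.
Qed.

(* A functional on the rational span of the l i is given by integers f i that
   respect every integer relation between the l i; the hypothesis f(l) = 0 makes
   f itself such a relation, whence the sum of the squares of the f i is 0. *)
Lemma relations_orthogonal_eq0 :
  (forall f : 'cV[int]_n,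
    (forall c : 'rV[int]_n, toK c *m l = 0 -> c *m f = 0) ->
    toK f^T *m l = 0) ->
  l = 0.
Proof.
move=> orthl; have [m [M [Ml maxM]]] := maximal_integer_relations.
(* The columns of the cokernel, cleared of denominators, vanish on every relation, so each is an
   admissible f and has zero sum of squares. Hence the relations have full rank. *)
have coker0 : cokermx (toQ M) = 0.
  have [d d0 [Z DZ]] := clear_denominators (cokermx (toQ M)).
  suff Z0 : Z = 0.
    apply/eqP; move/eqP: DZ; rewrite Z0 map_mx0 scaler_eq0 intr_eq0.
    by rewrite (negPf d0).
  apply/trmx_inj/row_matrixP => j; rewrite trmx0 row0 -tr_col.
  have orth_z (c : 'rV[int]_n) : toK c *m l = 0 -> c *m col j Z = 0.
    move=> /maxM/submxP[w Dc]; rewrite colE mulmxA.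
    suff -> : c *m Z = 0 by rewrite mul0mx.
    apply: map_intr_mx_inj.
    rewrite map_mxM map_mx0 -DZ Dc.
    by rewrite -scalemxAr -mulmxA mulmx_coker mulmx0 scaler0.
  have /matrixP/(_ 0 0)/eqP := orth_z _ (orthl _ orth_z); rewrite !mxE.
  rewrite psumr_eq0 => [/allP z0|i _]; last by rewrite !mxE -expr2 sqr_ge0.
  apply/rowP => i; rewrite !mxE; apply/eqP.
  by have := z0 i (mem_index_enum i); rewrite !mxE mulf_eq0 orbb.
(* By full rank, some nonzero integer multiple of each unit vector is a relation, so [l] is torsion,
   hence zero in characteristic zero. *)
have /submxP[w] : (1%:M <= toQ M)%MS by rewrite submxE coker0 mulmx0.
have [d d0 [z Dz]] := clear_denominators w.
move=> /(congr1 ( *:%R d%:~R)); rewrite scalemxAl Dz => Dd.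
have {}Dd : d%:M = z *m M.
  apply: map_intr_mx_inj.
  by rewrite map_mxM map_scalar_mx -Dd scalemx1.
have /eqP : toK d%:M *m l = 0 by rewrite Dd map_mxM -mulmxA Ml mulmx0.
rewrite map_scalar_mx mul_scalar_mx scaler_eq0 intr_eq0_pchar0 (negPf d0).
by move/eqP.
Qed.
End IntegerRelations.

(** * Lie algebras in coordinates *)

(* A Lie algebra on 'rV_n is given by the matrices A j of right bracketing with
   the j-th basis vector, so that [u, v] = u *m ad A v. *)
Definition ad (F : fieldType) n (A : 'I_n -> 'M[F]_n) (v : 'rV[F]_n) :
    'M[F]_n :=
  \sum_j v 0 j *: A j.

(** As [row i (A j)] is the bracket of two basis vectors, [ad_row] is the Jacobi identity in
    operator form. *)
Record lie_constants (F : fieldType) n (A : 'I_n -> 'M[F]_n) : Prop :=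
  LieConstants {
  row_skew : forall i j, row i (A j) = - row j (A i);
  ad_row : forall i j, ad A (row i (A j)) = A i *m A j - A j *m A i
}.

(** Row i of the sum is a sum of brackets of [row i (C j)] with the j-th basis vector; the equation
    says that brackets span the algebra. *)
Definition perfect (F : fieldType) n (A : 'I_n -> 'M[F]_n) : Prop :=
  exists C : 'I_n -> 'M[F]_n, \sum_j C j *m A j = 1%:M.

Section AdLinear.

Variables (F : fieldType) (n : nat) (A : 'I_n -> 'M[F]_n).

Fact ad_is_linear : linear (ad A).
Proof.
move=> a u v; rewrite /ad scaler_sumr -big_split /=; apply: eq_bigr => j _.
by rewrite !mxE scalerDl scalerA.
Qed.
HB.instance Definition _ :=
  GRing.isLinear.Build F 'rV[F]_n 'M[F]_n _ (ad A) ad_is_linear.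

Lemma ad_delta j : ad A (delta_mx 0 j) = A j.
Proof.
rewrite /ad (bigD1 j) //= mxE !eqxx scale1r big1 ?addr0 // => i ij.
by rewrite mxE eqxx (negPf ij) scale0r.
Qed.

Hypothesis lieA : lie_constants A.

Lemma mul_ad_skew u v : u *m ad A v = - (v *m ad A u).
Proof.
rewrite [v *m _]mulmx_sum_row -sumrN mulmx_sumr.
apply: eq_bigr => j _; rewrite -scalemxAr -scalerN; congr (_ *: _).
rewrite mulmx_sum_row /ad linear_sum -sumrN /=; apply: eq_bigr => i _.
by rewrite row_skew // linearZ /= scalerN.
Qed.

Lemma ad_mul_ad u v : ad A (u *m ad A v) = ad A u *m ad A v - ad A v *m ad A u.
Proof.
have E j : ad A (u *m A j) = ad A u *m A j - A j *m ad A u.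
  rewrite mulmx_sum_row linear_sum [ad A u]/ad mulmx_suml mulmx_sumr -sumrB.
  apply: eq_bigr => i _.
  by rewrite linearZ /= ad_row // -scalemxAl -scalemxAr scalerBr.
move: (ad A u) E => U E.
rewrite [ad A v]/ad !mulmx_sumr mulmx_suml linear_sum -sumrB.
apply: eq_bigr => j _.
by rewrite -!scalemxAr linearZ /= E -scalemxAl scalerBr.
Qed.

(** The product rule for [u *m Y] on the bracket of u and v, read as an identity of operators acting
    on u. *)
Definition derivation_mx (Y : 'M[F]_n) : Prop :=
  forall v, ad A v *m Y = Y *m ad A v + ad A (v *m Y).

Lemma derivation_mx_ad a : derivation_mx (ad A a).
Proof. by move=> v; rewrite ad_mul_ad addrC subrK. Qed.

(** Cyclicity of the trace moves the commutator of [ad A u] and [ad A v] onto [ad A v] and [Y],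
    where the product rule evaluates it. *)
Lemma mxtrace_derivation_bracket Y u v : derivation_mx Y ->
  \tr (Y *m ad A (u *m ad A v)) = \tr (ad A (v *m Y) *m ad A u).
Proof.
move=> derY; rewrite ad_mul_ad mulmxBr raddfB /= mulmxA mxtrace_mulC mulmxA.
by rewrite derY mulmxDl mxtraceD !mulmxA addrC addKr.
Qed.

Lemma mxtrace_derivation_ad_eq0 Y x : derivation_mx Y -> perfect A ->
  (forall u v, \tr (ad A u *m ad A v) = 0) -> \tr (Y *m ad A x) = 0.
Proof.
move=> derY [C sumC] kill0; rewrite -[x]mulmx1 -sumC mulmx_sumr.
rewrite (linear_sum (ad A)) mulmx_sumr raddf_sum big1 //= => j _.
by rewrite mulmxA -ad_delta mxtrace_derivation_bracket.
Qed.

End AdLinear.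

(** * Nilpotency of ad x when the Killing form vanishes *)

Section KillingZero.

Variables (K : fieldType) (n' : nat).
Local Notation n := n'.+1.
Variables (A : 'I_n -> 'M[K]_n) (x : 'rV[K]_n).
Hypothesis charK : [pchar K] =i pred0.
Hypothesis lieA : lie_constants A.

Local Notation X := (ad A x).

(** By the product rule, [X - (a + b)] applied to the bracket gives two brackets, each with one
    exponent lowered; induct on [m + k]. *)
Lemma bracket_generalized_eigenvector (u v : 'rV[K]_n) a b m k :
  u *m (X - a%:M) ^+ m = 0 -> v *m (X - b%:M) ^+ k = 0 ->
  (u *m ad A v) *m (X - (a + b)%:M) ^+ (m + k) = 0.
Proof.
have [N] := ubnP (m + k)%N; elim: N => // N IHN in u v m k *.
case: m => [_|m]; first by rewrite expr0 mulmx1 => ->; rewrite !mul0mx.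
case: k => [_ _|k].
  by rewrite expr0 mulmx1 => ->; rewrite linear0 mulmx0 mul0mx.
move=> /ltnSE lt_mk um vk; rewrite addSn exprS -mulmxE mulmxA.
have -> : u *m ad A v *m (X - (a + b)%:M) =
    (u *m (X - a%:M)) *m ad A v + u *m ad A (v *m (X - b%:M)).
  rewrite !mulmxBr -mulmxA (derivation_mx_ad lieA) !mul_mx_scalar.
  rewrite scalerDl mulmxBl linearB linearZ /= mulmxBr mulmxDr -scalemxAl.
  by rewrite -scalemxAr !mulmxA addrACA opprD.
rewrite mulmxDl (IHN _ _ m k.+1) ?add0r // -?addSnnS; last first.
  by rewrite -mulmxA mulmxE -exprS.
apply: (IHN _ _ m.+1 k) => //; first by rewrite addSnnS.
by rewrite -mulmxA mulmxE -exprS.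
Qed.

Lemma kermxpoly_dvd (g : 'M[K]_n) p q :
  p %| q -> (kermxpoly g p <= kermxpoly g q)%MS.
Proof.
move=> /dvdpP[r ->]; apply/sub_kermxP; rewrite mulrC rmorphM -mulmxE mulmxA.
by rewrite mulmx_ker mul0mx.
Qed.

Lemma sub_kermxpoly_XsubC_exp (g : 'M[K]_n) (w : 'rV_n) a m :
  (w <= kermxpoly g (('X - a%:P) ^+ m))%MS = (w *m (g - a%:M) ^+ m == 0).
Proof.
by rewrite (sameP sub_kermxP eqP) rmorphXn rmorphB /= horner_mx_X horner_mx_C.
Qed.

Section Eigenbasis.

Variables (B T : 'M[K]_n) (Y : 'M[K]_n) (f : 'I_n -> K).
Hypotheses (unitB : B \in unitmx) (BX : B *m X = T *m B).
Hypothesis genB : forall i, row i B *m (X - (T i i)%:M) ^+ n = 0.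
Hypothesis BY : forall i, row i B *m Y = f i *: row i B.

(** Only rows of [B] with eigenvalue [b] occur in [w]: the remaining part [w2] is killed by a power
    of [X - b], as [w] and [w1] are, and by the coprime polynomial [q], so it is zero. *)
Lemma generalized_eigenvector_eigen (w : 'rV[K]_n) b m c :
  w *m (X - b%:M) ^+ m = 0 -> (forall k, T k k = b -> f k = c) ->
  w *m Y = c *: w.
Proof.
move=> wb fb; pose a := w *m invmx B.
have Dw : w = \sum_k a 0 k *: row k B by rewrite -mulmx_sum_row mulmxKV.
pose w1 := \sum_(k | T k k == b) a 0 k *: row k B.
pose w2 := \sum_(k | T k k != b) a 0 k *: row k B.
have Dw12 : w = w1 + w2 by rewrite Dw (bigID (fun k => T k k == b)).
pose p := ('X - b%:P) ^+ (m + n).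
pose q := \prod_(k | T k k != b) ('X - (T k k)%:P) ^+ n.
have w2p : (w2 <= kermxpoly X p)%MS.
  have -> : w2 = w - w1 by rewrite Dw12 addrC addKr.
  apply: addmx_sub; last rewrite eqmx_opp; rewrite ?summx_sub //.
    by rewrite sub_kermxpoly_XsubC_exp exprD -mulmxE mulmxA wb mul0mx.
  move=> k /eqP Tk; apply: scalemx_sub; rewrite sub_kermxpoly_XsubC_exp.
  by rewrite addnC exprD -mulmxE mulmxA -Tk genB mul0mx.
have w2q : (w2 <= kermxpoly X q)%MS.
  apply: summx_sub => k Tk; apply: scalemx_sub.
  apply: (submx_trans _ (@kermxpoly_dvd X (('X - (T k k)%:P) ^+ n) q _)).
    by rewrite sub_kermxpoly_XsubC_exp genB.
  by rewrite /q (bigD1 k) //= dvdp_mulr.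
have cop : coprimep p q.
  rewrite coprimep_expl // coprimep_sym.
  apply: (big_ind (fun r => coprimep r ('X - b%:P))); rewrite ?coprime1p //.
    by move=> r s cr cs; rewrite coprimepMl cr.
  move=> k Tk; rewrite coprimep_expl // coprimep_XsubC root_XsubC eq_sym.
  exact: Tk.
have w20 : w2 = 0.
  by apply/eqP; rewrite -submx0 -(mxdirect_kermxpoly X cop) sub_capmx w2p.
rewrite Dw12 w20 addr0 /w1 mulmx_suml scaler_sumr; apply: eq_bigr => k /eqP Tk.
by rewrite -scalemxAl BY (fb k Tk) !scalerA mulrC.
Qed.

Hypothesis addf :
  forall i j k, T k k = T i i + T j j -> f k = f i + f j.

(** The bracket of rows j and i of [B] is a generalized eigenvector for [T j j + T i i], so by
    additivity [Y] scales it by [f j + f i], as the product rule demands. *)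
Lemma derivation_mx_eigenbasis : derivation_mx A Y.
Proof.
have derB i : ad A (row i B) *m Y = Y *m ad A (row i B) + ad A (row i B *m Y).
  apply: (can_inj (mulKmx unitB)); apply/row_matrixP => j.
  rewrite !row_mul mulmxDr BY linearZ /= !mulmxA BY -scalemxAl.
  rewrite -scalemxAr -scalerDl.
  apply: (generalized_eigenvector_eigen
            (bracket_generalized_eigenvector (genB j) (genB i))) => k.
  exact: addf.
move=> v; rewrite -(mulmxKV unitB v); move: (v *m _) => a.
rewrite mulmx_sum_row (linear_sum (ad A)) !mulmx_suml mulmx_sumr linear_sum.
rewrite -big_split /=; apply: eq_bigr => i _.
rewrite [ad A (_ *: _)]linearZ /= -!scalemxAl derB -scalemxAr.
by rewrite [ad A (_ *: _)]linearZ scalerDr.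
Qed.

End Eigenbasis.

Lemma killing_zero_ad_nilpotent (rs : seq K) : perfect A ->
  (forall u v, \tr (ad A u *m ad A v) = 0) ->
  char_poly X %= \prod_(r <- rs) ('X - r%:P) -> X ^+ n = 0.
Proof.
move=> perfA kill0 split_X.
have [B [T [unitB BX genB]]] := generalized_eigenbasis split_X.
suff T0 : \col_i T i i = 0.
  apply: (can_inj (mulKmx unitB)); apply/row_matrixP => i.
  have := genB i; have /colP/(_ i) := T0; rewrite !mxE => ->.
  by rewrite raddf0 subr0 row_mul mulmx0 row0.
apply: (relations_orthogonal_eq0 charK) => f orthf.
pose D : 'M[K]_n := diag_mx (map_mx intr f^T); pose Y := invmx B *m D *m B.
have BY i : row i B *m Y = (f i 0)%:~R *: row i B.
  rewrite -row_mul !mulmxA mulmxV // mul1mx row_mul row_diag_mx !mxE.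
  by rewrite -scalemxAl -rowE.
have derY : derivation_mx A Y.
  apply: (derivation_mx_eigenbasis unitB genB BY) => i j k Tk.
  (* The equality [Tk] between eigenvalues is itself an integer relation, which [f] respects. *)
  have := orthf (delta_mx 0 k - delta_mx 0 i - delta_mx 0 j).
  rewrite !map_mxB !map_delta_mx !mulmxBl -!rowE => /(_ _)/matrixP/(_ 0 0).
  rewrite !mxE => Df; apply/eqP; rewrite -subr_eq0 opprD addrA -!rmorphB /=.
  rewrite Df //.
  by apply/rowP => z; rewrite ord1 !mxE Tk -addrA -opprD subrr.
apply/rowP => z; rewrite ord1 {z}.
have := mxtrace_derivation_ad_eq0 lieA x derY perfA kill0.
(* In the basis [B] the trace of [Y *m X] becomes that of [D *m T]; as [D] is diagonal, only the
   diagonal of [T] enters. *)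
have -> : Y *m X = invmx B *m (D *m (B *m X)) by rewrite !mulmxA.
rewrite mxtrace_mulC BX -!mulmxA mulmxV // mulmx1 mul_diag_mx => tr0.
rewrite [RHS]mxE -[RHS]tr0.
by rewrite !mxE; apply: eq_bigr => i _; rewrite !mxE.
Qed.

End KillingZero.

Lemma map_ad (F K : fieldType) (iota : {rmorphism F -> K}) n
    (A : 'I_n -> 'M[F]_n) v :
  map_mx iota (ad A v) = ad (fun j => map_mx iota (A j)) (map_mx iota v).
Proof.
rewrite /ad map_mx_sum; apply: eq_bigr => j _.
by rewrite map_mxZ !mxE.
Qed.

Definition killing_mx (F : fieldType) n (A : 'I_n -> 'M[F]_n) : 'M[F]_n :=
  \matrix_(i, j) \tr (A i *m A j).

Lemma mxtrace_ad_ad (F : fieldType) n (A : 'I_n -> 'M[F]_n) u v :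
  \tr (ad A u *m ad A v) = (u *m killing_mx A *m v^T) 0 0.
Proof.
rewrite /ad mulmx_sumr raddf_sum mxE; apply: eq_bigr => j _ /=.
rewrite -scalemxAr mxtraceZ mulmx_suml mulrC [v^T _ _]mxE [in RHS]mxE.
congr (_ * _); rewrite raddf_sum; apply: eq_bigr => i _.
by rewrite -scalemxAl [LHS]mxtraceZ mxE.
Qed.

(** * Engel's theorem, nondegeneracy of the Killing form and inner derivations *)

Section SimpleLie.

Variables (F : fieldType) (n' : nat).
Local Notation n := n'.+1.
Variable A : 'I_n -> 'M[F]_n.
Hypothesis charF : [pchar F] =i pred0.
Hypothesis lieA : lie_constants A.

Lemma ad_nilpotent_of_killing_zero x : perfect A ->
  (forall u v, \tr (ad A u *m ad A v) = 0) -> ad A x ^+ n = 0.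
Proof.
move=> [C sumC] kill0.
have char0 : char_poly (ad A x) != 0 by rewrite monic_neq0 ?char_poly_monic.
have [K [iota [rs]]] := splits_in_extension char0.
rewrite map_char_poly map_ad; set A' := fun j => _ => split_x.
apply: (@map_mx_inj _ _ iota); rewrite rmorphXn map_mx0 /= map_ad -/A'.
apply: killing_zero_ad_nilpotent split_x.
- by move=> p; rewrite (fmorph_pchar iota) charF.
- have [skew jac] := lieA; split=> i j; first by rewrite -!map_row skew map_mxN.
  by rewrite -map_row -map_ad jac map_mxB !map_mxM.
- exists (fun j => map_mx iota (C j)); rewrite -(map_mx1 iota) -sumC map_mx_sum.
  by apply: eq_bigr => j _; rewrite map_mxM.
- move=> u v; rewrite mxtrace_ad_ad.
  (* The hypothesis covers vectors over [F] only; it reaches those over [K] through the Gram matrix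
     on the basis. *)
  suff -> : killing_mx A' = 0.
    by rewrite mulmx0 mul0mx mxE.
  apply/matrixP => i j; rewrite !mxE -map_mxM trace_map_mx -!(ad_delta A) kill0.
  exact: rmorph0.
Qed.

Lemma mul_ad_diag u : u *m ad A u = 0.
Proof.
apply/eqP; have /eqP := mul_ad_skew lieA u u.
rewrite -addr_eq0 -mulr2n -scaler_nat scaler_eq0.
by have/pcharf0P -> := charF.
Qed.

Definition ad_stable (T U : 'M[F]_n) :=
  forall t : 'rV_n, (t <= T)%MS -> (U *m ad A t <= U)%MS.

(** [T] is a subalgebra of dimension k, and the last clause is Engel's theorem for its action modulo
    [U]. Taking [U] to be [T] itself gives a [y] outside [T] normalizing it, and [T + y] is the next
    subalgebra. *)
Lemma engel_chain k : (forall x, ad A x ^+ n = 0) -> (k <= n)%N ->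
  exists T : 'M[F]_n, [/\ \rank T = k, ad_stable T T &
    forall U W : 'M[F]_n, ad_stable T U -> ad_stable T W -> ~~ (W <= U)%MS ->
    exists v : 'rV[F]_n, [/\ (v <= W)%MS, ~~ (v <= U)%MS &
      forall t : 'rV_n, (t <= T)%MS -> (v *m ad A t <= U)%MS]].
Proof.
move=> nil; elim: k => [_ | k IHk lt_kn].
  have ad0 (t : 'rV[F]_n) : (t <= (0 : 'M[F]_n))%MS -> ad A t = 0.
    by rewrite submx0 => /eqP->; rewrite linear0.
  exists 0; split=> [|t /ad0-> | U W _ _ /row_subPn[i nUi]].
  - exact: mxrank0.
  - by rewrite mulmx0 sub0mx.
  by exists (row i W); split=> [||t /ad0->]; rewrite ?row_sub ?mulmx0 ?sub0mx.
have [T [rkT subT flagT]] := IHk (ltnW lt_kn).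
have [||y [_ nTy yT]] := flagT T 1%:M subT.
- by move=> t _; rewrite submx1.
- by apply/negP => /mxrankS; rewrite mxrank1 rkT leqNgt lt_kn.
pose T1 := (T + y)%MS.
have ad_T1 t : (t <= T1)%MS ->
    exists2 t0 : 'rV_n, (t0 <= T)%MS & exists c, ad A t = ad A t0 + c *: ad A y.
  move=> /sub_addsmxP[[a c] /= ->]; exists (a *m T); first exact: submxMl.
  exists (c 0 0); rewrite linearD /= [c]mx11_scalar mul_scalar_mx linearZ.
  by rewrite mxE mulr1n.
have sub_yT1 : (y <= T1)%MS by apply: addsmxSr.
have stab_T U : ad_stable T1 U -> ad_stable T U.
  by move=> stU t tT; apply/stU/(submx_trans tT)/addsmxSl.
exists T1; split.
- apply/eqP; rewrite eqn_leq; apply/andP; split.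
    rewrite (leq_trans (mxrank_adds_leqif T y)) // rkT.
    by rewrite -[leqRHS]addn1 leq_add2l rank_leq_row.
  rewrite -rkT ltn_neqAle mxrankS ?addsmxSl // andbT.
  by rewrite (mxrank_leqif_sup (addsmxSl _ _)).2 addsmx_sub submx_refl.
- move=> t /ad_T1[t0 t0T [c ->]].
  rewrite addsmxMr addsmx_sub !mulmxDr -!scalemxAr mul_ad_diag scaler0 addr0.
  rewrite (submx_trans (yT t0 t0T)) ?addsmxSl // andbT.
  rewrite (submx_trans _ (addsmxSl T y)) // addmx_sub ?subT // scalemx_sub //.
  apply/row_subP => i; rewrite row_mul mul_ad_skew // eqmx_opp.
  by rewrite yT ?row_sub.
move=> U W stU stW nWU.
have [v [vW nUv vT]] := flagT U W (stab_T _ stU) (stab_T _ stW) nWU.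
pose vy m := v *m ad A y ^+ m.
have vyS m : vy m.+1 = vy m *m ad A y by rewrite /vy exprSr mulmxA.
have vyW m : (vy m <= W)%MS.
  elim: m => [|m IHm]; first by rewrite /vy expr0 mulmx1.
  by rewrite vyS (submx_trans (submxMr _ IHm)) ?stW.
(* Bracketing with [y] preserves being killed by [T] modulo [U], because [y *m ad A t] lies in
   [T]. *)
have vyT m t : (t <= T)%MS -> (vy m *m ad A t <= U)%MS.
  elim: m t => [|m IHm] t tT; first by rewrite /vy expr0 mulmx1 vT.
  have -> : vy m.+1 *m ad A t =
      vy m *m ad A t *m ad A y + vy m *m ad A (y *m ad A t).
    by rewrite ad_mul_ad // mulmxBr vyS !mulmxA addrC subrK.
  by rewrite addmx_sub ?IHm ?yT // (submx_trans (submxMr _ (IHm t tT))) ?stU.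
(* Nilpotency of [ad A y] yields a last iterate outside [U], which [y] also sends into [U]. *)
have ex_m : exists m, (vy m <= U)%MS by exists n; rewrite /vy nil mulmx0 sub0mx.
have [[|m] Um min_m] := ex_minnP ex_m.
  by rewrite /vy expr0 mulmx1 (negPf nUv) in Um.
exists (vy m); split=> // [|t /ad_T1[t0 t0T [c ->]]].
  by apply/negP => /min_m; rewrite ltnn.
by rewrite mulmxDr -scalemxAr -vyS addmx_sub ?vyT // scalemx_sub.
Qed.

Lemma ad_nilpotent_central : (forall x, ad A x ^+ n = 0) ->
  exists2 v : 'rV[F]_n, v != 0 & forall t, v *m ad A t = 0.
Proof.
move=> nil; have [T [rkT _ flagT]] := engel_chain nil (leqnn n).
have [|||v [_ v0 vT]] := flagT 0 1%:M.
- by move=> t _; rewrite mul0mx sub0mx.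
- by move=> t _; apply: submx1.
- by rewrite submx0 oner_eq0.
exists v => [|t]; first by rewrite -submx0.
by apply/eqP; rewrite -submx0 vT // submx_full // /row_full rkT.
Qed.

Hypothesis simpleA : forall J : 'M[F]_n,
  (forall v, (J *m ad A v <= J)%MS) -> J = 0 \/ row_full J.
Hypothesis nonabelianA : exists v, ad A v <> 0.

(** The row spaces of the [A j] together span the derived algebra, a nonzero ideal. *)
Lemma simple_perfect : perfect A.
Proof.
have [v | J0 | Jfull] := simpleA (J := (\sum_j A j)%MS).
- apply: submx_trans (submxMl _ _) _; rewrite /ad summx_sub_sums // => j _.
  exact: scalemx_sub.
- case: nonabelianA => v []; apply: big1 => j _.
  suff -> : A j = 0 by rewrite scaler0.
  by apply/eqP; rewrite -submx0 -J0 (sumsmx_sup j).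
have /sub_sumsmxP[C DC] : (1%:M <= \sum_j A j)%MS by rewrite sub1mx.
by exists C.
Qed.

Lemma simple_center_eq0 (v : 'rV[F]_n) : (forall t, v *m ad A t = 0) -> v = 0.
Proof.
move=> cv; have cJ t : (<<v>> *m ad A t = 0)%MS.
  have /submxP[c ->] : (<<v>> <= v)%MS by rewrite genmxE.
  by rewrite -mulmxA cv mulmx0.
have [t | J0 | Jfull] := simpleA (J := <<v>>%MS).
- by rewrite cJ sub0mx.
- by apply/eqP; rewrite -submx0 -J0 genmxE.
case: nonabelianA => t []; rewrite -[ad A t]mul1mx.
have /submxP[c ->] : (1%:M <= <<v>>)%MS by rewrite sub1mx.
by rewrite -mulmxA cJ mulmx0.
Qed.

Lemma killing_mx_unit : killing_mx A \in unitmx.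
Proof.
rewrite -row_free_unit -kermx_eq0.
have [v | -> // | kerfull] := simpleA (J := kermx (killing_mx A)).
  apply/sub_kermxP/row_matrixP => i; rewrite 2!row_mul row0.
  set u := row i _; have uK : u *m killing_mx A = 0.
    by apply/sub_kermxP; apply: row_sub.
  apply/rowP => j.
  have trj (w : 'rV_n) : (w *m killing_mx A) 0 j = \tr (ad A w *m A j).
    by rewrite -[A j]ad_delta mxtrace_ad_ad trmx_delta -colE [RHS]mxE.
  (* Invariance of the Killing form: the bracket with [v] passes from [u] to the j-th basis vector,
     and [u] is in the radical. *)
  rewrite trj ad_mul_ad // mulmxBl raddfB /= -!mulmxA.
  rewrite [\tr (ad A v *m _)]mxtrace_mulC -!mulmxA -raddfB -mulmxBr /= -[A j]ad_delta.
  have /eqP := ad_mul_ad lieA v (delta_mx 0 j); rewrite eq_sym => /eqP ->.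
  by rewrite mxtrace_ad_ad uK mul0mx !mxE.
have kill0 : killing_mx A = 0.
  by rewrite -[killing_mx A]mul1mx; apply/sub_kermxP; rewrite sub1mx.
have kill u v : \tr (ad A u *m ad A v) = 0.
  by rewrite mxtrace_ad_ad kill0 mulmx0 mul0mx mxE.
have nil x : ad A x ^+ n = 0.
  exact: ad_nilpotent_of_killing_zero simple_perfect kill.
have [v v0 /simple_center_eq0 v_eq0] := ad_nilpotent_central nil.
by rewrite v_eq0 eqxx in v0.
Qed.

(** Nondegeneracy gives [a] with [D] and [ad A a] having equal traces against every [ad A v]. Their
    difference [E] is a derivation with zero traces, so the bracket trace formula puts its image in
    the radical. *)
Lemma simple_derivation_inner D : derivation_mx A D -> exists a, D = ad A a.
Proof.
move=> derD.
pose a := (\row_j \tr (D *m A j)) *m invmx (killing_mx A).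
have tr_aE v : \tr (D *m ad A v) = \tr (ad A a *m ad A v).
  rewrite mxtrace_ad_ad mulmxKV ?killing_mx_unit //.
  rewrite {1}/ad mulmx_sumr raddf_sum !mxE; apply: eq_bigr => j _.
  by rewrite !mxE /= -scalemxAr linearZ mulrC.
exists a; apply/eqP; rewrite -subr_eq0; set E := D - _.
have derE : derivation_mx A E.
  move=> v; rewrite /E !(mulmxBr, mulmxBl) linearB /= derD.
  by rewrite (derivation_mx_ad lieA a) opprD addrACA.
have EK : E *m killing_mx A = 0.
  apply/row_matrixP => i; apply/rowP => j; rewrite row_mul row0.
  have := mxtrace_derivation_bracket lieA (delta_mx 0 j) (delta_mx 0 i) derE.
  rewrite mulmxBl raddfB /= tr_aE subrr => /esym.
  rewrite mxtrace_ad_ad trmx_delta -colE -rowE mxE => ->.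
  by rewrite mxE.
by rewrite -(mulmxK killing_mx_unit E) EK mul0mx.
Qed.

End SimpleLie.

(** * Leibniz algebras *)

Section LinearCombination.

Variables (F : fieldType) (L : vectType F) (n : nat) (e : n.-tuple L).

Definition lincomb (u : 'rV[F]_n) : L := \sum_i u 0 i *: e`_i.

Fact lincomb_is_linear : linear lincomb.
Proof.
move=> a u v; rewrite /lincomb scaler_sumr -big_split /=; apply: eq_bigr => i _.
by rewrite !mxE scalerDl scalerA.
Qed.
HB.instance Definition _ :=
  GRing.isLinear.Build F 'rV[F]_n L _ lincomb lincomb_is_linear.

Definition coordinates (x : L) : 'rV[F]_n := \row_i coord e i x.

Lemma lincomb_delta i : lincomb (delta_mx 0 i) = e`_i.
Proof.
rewrite /lincomb (bigD1 i) //= mxE !eqxx scale1r big1 ?addr0 // => j ij.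
by rewrite mxE eqxx (negPf ij) scale0r.
Qed.

Variable G : {vspace L}.
Hypothesis basis_e : basis_of G e.

Lemma lincomb_mem u : lincomb u \in G.
Proof.
apply: memv_suml => i _; apply/memvZ/(basis_mem basis_e)/mem_nth.
by rewrite size_tuple.
Qed.

Lemma lincomb_coordinates x : x \in G -> lincomb (coordinates x) = x.
Proof.
move=> Gx; rewrite [RHS](coord_basis basis_e Gx); apply: eq_bigr => i _.
by rewrite mxE.
Qed.

Lemma lincomb_inj : injective lincomb.
Proof.
move=> u v eq_uv; apply/rowP => i.
rewrite -(coord_sum_free (fun i => u 0 i) i (basis_free basis_e)).
by rewrite -/(lincomb u) eq_uv coord_sum_free // (basis_free basis_e).
Qed.

End LinearCombination.

(** * Transfer between subspaces of L and coordinates *)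

Section InnerDerivations.

Variables (F : fieldType) (L : vectType F) (br : {bilinear L -> L -> L}).
Variables (G : {vspace L}) (n' : nat).
Local Notation n := n'.+1.
Variable e : n.-tuple L.
Hypothesis basis_e : basis_of G e.
Hypothesis charF : [pchar F] =i pred0.
Hypothesis leibL : leibniz br.
Hypothesis simpleG : simple_lie_subalgebra br G.

Definition bracket_mx (j : 'I_n) : 'M[F]_n :=
  \matrix_i coordinates e (br e`_i e`_j).

Local Notation phi := (lincomb e).

Lemma lie_bracket_skew x y : x \in G -> y \in G -> br x y = - br y x.
Proof.
have [[_ alt _] _ _] := simpleG.
move=> Gx Gy; apply/eqP; rewrite -addr_eq0; have := alt _ (memvD Gx Gy).
by rewrite linearDl !linearDr /= !alt // add0r addr0 => ->.
Qed.

Lemma lincomb_bracket u v : phi (u *m ad bracket_mx v) = br (phi u) (phi v).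
Proof.
have [[closedG _ _] _ _] := simpleG.
have Ge (i : 'I_n) : e`_i \in G by rewrite -lincomb_delta lincomb_mem.
rewrite mulmx_sum_row linear_sum /= [in RHS]/lincomb linear_sumlz.
apply: eq_bigr => i _; rewrite linearZ linearZl_LR /=; congr (_ *: _).
rewrite linear_sumr !linear_sum /=.
apply: eq_bigr => j _; rewrite linearZ linearZr_LR linearZ /=; congr (_ *: _).
by rewrite rowK (lincomb_coordinates basis_e) ?closedG.
Qed.

Lemma row_bracket_mx i j : phi (row i (bracket_mx j)) = br e`_i e`_j.
Proof.
by rewrite rowE -[bracket_mx j]ad_delta lincomb_bracket !lincomb_delta.
Qed.

Lemma bracket_mx_lie : lie_constants bracket_mx.
Proof.
have Ge (i : 'I_n) : e`_i \in G by rewrite -lincomb_delta lincomb_mem.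
split=> i j; first apply: (lincomb_inj basis_e).
  by rewrite linearN /= !row_bracket_mx lie_bracket_skew.
apply/row_matrixP => k; apply: (lincomb_inj basis_e).
rewrite rowE lincomb_bracket row_bracket_mx lincomb_delta linearB linearB /=.
rewrite !row_mul leibL -[in X in _ = X - _](ad_delta bracket_mx j).
rewrite -[in X in _ = _ - X](ad_delta bracket_mx i).
by rewrite !lincomb_bracket !row_bracket_mx !lincomb_delta.
Qed.

Lemma bracket_mx_simple (J : 'M[F]_n) :
  (forall v, (J *m ad bracket_mx v <= J)%MS) -> J = 0 \/ row_full J.
Proof.
move=> idJ; have [[closedG _ _] _ minG] := simpleG.
(* [V] is the image under [phi] of the row space of [J]. *)
pose V := limg (linfun (phi \o mulmxr J)).
have memV x : reflect (exists2 u : 'rV_n, (u <= J)%MS & x = phi u) (x \in V).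
  apply: (iffP memv_imgP) => [[w _]|[u /submxP[w ->]] ->].
    by rewrite lfunE /= => ->; exists (w *m J); rewrite ?submxMl.
  by exists w; rewrite ?memvf // lfunE.
have VG : (V <= G)%VS by apply/subvP => x /memV[u _ ->]; apply: lincomb_mem.
have [| V0 | VeqG] := minG V.
- split=> // x y Vx Gy.
  suff Vxy : br x y \in V.
    by rewrite (lie_bracket_skew Gy (subvP VG x Vx)) memvN.
  have [u uJ ->] := memV _ Vx; apply/memV.
  exists (u *m ad bracket_mx (coordinates e y)).
    exact: submx_trans (submxMr _ uJ) (idJ _).
  by rewrite lincomb_bracket (lincomb_coordinates basis_e).
- left; apply/row_matrixP => i; apply: (lincomb_inj basis_e).
  rewrite row0 linear0; apply/eqP; rewrite -memv0 -V0; apply/memV.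
  by exists (row i J); rewrite ?row_sub.
right; rewrite -sub1mx; apply/row_subP => i; rewrite row1.
have /memV[u uJ /(lincomb_inj basis_e) -> //] : phi (delta_mx 0 i) \in V.
by rewrite VeqG lincomb_mem.
Qed.

Lemma bracket_mx_nonabelian : exists v, ad bracket_mx v <> 0.
Proof.
have [_ GG0 _] := simpleG.
have [/forallP ab | nab] := boolP [forall j, bracket_mx j == 0].
  case: GG0; apply/eqP; rewrite -subv0; apply/brv_subP => x y Gx Gy.
  rewrite -(lincomb_coordinates basis_e Gx) -(lincomb_coordinates basis_e Gy).
  rewrite -lincomb_bracket /ad big1 ?mulmx0 ?linear0 ?mem0v // => j _.
  by rewrite (eqP (ab j)) scaler0.
move: nab; rewrite negb_forall => /existsP[j /eqP Aj0].
by exists (delta_mx 0 j); rewrite ad_delta.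
Qed.

Lemma simple_lie_derivation_inner_basis (D : 'End(L)) :
  (forall x, x \in G -> D x \in G) ->
  (forall x y, x \in G -> y \in G -> D (br x y) = br (D x) y + br x (D y)) ->
  exists2 a, a \in G & forall x, x \in G -> D x = br x a.
Proof.
move=> DG derD; pose M : 'M[F]_n := \matrix_i coordinates e (D e`_i).
have phiM u : phi (u *m M) = D (phi u).
  rewrite mulmx_sum_row !linear_sum /=; apply: eq_bigr => i _.
  rewrite !linearZ /= rowK (lincomb_coordinates basis_e) // DG //.
  by rewrite -lincomb_delta lincomb_mem.
have derM : derivation_mx bracket_mx M.
  move=> v; apply/row_matrixP => i; apply: (lincomb_inj basis_e).
  rewrite linearD linearD /= !row_mul [row i (ad _ (_ *m _))]rowE.
  rewrite phiM !lincomb_bracket [row i (ad _ _)]rowE lincomb_bracket derD.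
    by rewrite [row i M]rowE !phiM.
    exact: lincomb_mem.
  exact: lincomb_mem.
have [a Da] := simple_derivation_inner charF bracket_mx_lie bracket_mx_simple
  bracket_mx_nonabelian derM.
exists (phi a) => [|x Gx]; first exact: lincomb_mem.
by rewrite -(lincomb_coordinates basis_e Gx) -phiM Da lincomb_bracket.
Qed.

End InnerDerivations.

Lemma simple_lie_derivation_inner (F : fieldType) (L : vectType F)
    (br : {bilinear L -> L -> L}) (G : {vspace L}) (D : 'End(L)) :
  [pchar F] =i pred0 -> leibniz br -> simple_lie_subalgebra br G ->
  (forall x, x \in G -> D x \in G) ->
  (forall x y, x \in G -> y \in G -> D (br x y) = br (D x) y + br x (D y)) ->
  exists2 a, a \in G & forall x, x \in G -> D x = br x a.
Proof.
move=> charF leibL simpleG DG derD.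
(* The coordinate results are stated for positive dimension; dimension zero is settled with a =
   0. *)
case: (\dim G) (vbasis G) (vbasisP G) => [|n] e basis_e; last first.
  exact: (simple_lie_derivation_inner_basis
            basis_e charF leibL simpleG DG derD).
exists 0 => [|x]; first exact: mem0v.
rewrite -(span_basis basis_e) tuple0 span_nil memv0 => /eqP->.
by rewrite !linear0.
Qed.

(** * The ideal of squares *)

Section Leibniz.

Variables (F : fieldType) (L : vectType F) (br : {bilinear L -> L -> L}).
Variable I : {vspace L}.
Hypothesis leibL : leibniz br.
Hypothesis sqI : squares_ideal br I.

(** The elements [z] with [L, z] = 0 form an ideal containing all squares, both by the Leibniz
    identity, so this ideal contains [I]. *)
Lemma br_squares_ideal_eq0 x z : z \in I -> br x z = 0.
Proof.
pose Z := (\bigcap_(i < \dim {:L}) lker (linfun (br (vbasis {:L})`_i)))%VS.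
have memZ y : reflect (forall w, br w y = 0) (y \in Z).
  rewrite memvE; apply: (iffP subv_bigcapP) => [yZ w | y0 i _].
    rewrite (coord_vbasis (memvf w)) linear_sumlz big1 // => i _.
    have := yZ i isT; rewrite -memvE memv_ker lfunE => /eqP yi.
    by rewrite linearZl_LR yi scaler0.
  by rewrite -memvE memv_ker lfunE /= y0.
have [_ _ minI] := sqI => Iz; suff /subvP/(_ z Iz)/memZ-> : (I <= Z)%VS by [].
apply: minI => [|_ [y ->]]; last first.
  by apply/memZ => w; rewrite leibL subrr.
split=> [|y w /memZ y0 _]; first exact: subvf.
by split; apply/memZ => v; rewrite leibL !y0 ?linear0r ?linear0l ?subrr.
Qed.

Lemma derivation_squares_ideal d x : derivation br d -> x \in I -> d x \in I.
Proof.
move=> derd Ix; have [[_ idI] sqmI minI] := sqI.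
have sq y : br y y \in I by apply: sqmI; exists y.
(* Intersecting with [I] makes this an ideal: in d[y, w] the term [y, d w] lies in [I] because y
   does. Squares are handled by polarization. *)
suff /subvP/(_ x Ix) : (I <= I :&: d @^-1: I)%VS.
  by rewrite memv_cap -memv_preim => /andP[].
apply: minI => [|_ [y ->]]; last first.
  rewrite memv_cap sq -memv_preim derd /=.
  have -> : br (d y) y + br y (d y) =
      br (d y + y) (d y + y) - br (d y) (d y) - br y y.
    rewrite linearDl !linearDr /= [RHS]addrAC addrA addrK [RHS]addrC -addrA.
    by rewrite addKr.
  by rewrite !memvB.
split=> [|y w]; first exact: subvf.
rewrite !memv_cap -!memv_preim => /andP[Iy Idy] _.
have [Iyw Iwy] := idI y w Iy (memvf w).
have [Idyw Iwdy] := idI (d y) w Idy (memvf w).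
have [Iydw Idwy] := idI y (d w) Iy (memvf _).
by rewrite Iyw Iwy !derd !memvD.
Qed.

Lemma derivation_rmul a : derivation br (rmul br a).
Proof. by move=> x y; rewrite !rmulE leibL addrC subrK. Qed.

End Leibniz.

(** * Decomposition of a derivation *)

Theorem theorem3p2 (F : fieldType) (L : vectType F)
    (br : {bilinear L -> L -> L}) (G I : {vspace L}) (d : 'End(L)) :
  [pchar F] =i pred0 ->
  simple_leibniz br ->
  squares_ideal br I ->
  simple_lie_subalgebra br G ->
  (G + I)%VS = fullv ->
  directv (G + I) ->
  derivation br d ->
  exists (a : L) (alpha delta : 'End(L)),
    [/\ a \in G,
        extends_by_zero I G I alpha,
        extends_by_zero G I I delta,
        d = rmul br a + alpha + delta
      & (forall x y : L, alpha (br x y) = br (alpha x) y) /\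
        (alpha = 0 \/ (alpha @: I)%VS = I)].
Proof.
move=> charF [leibL [I1 [sqI1 minI _]]] sqI simpleG.
move=> GI_full /directv_addP GI0 derd.
have IG0 : (I :&: G = 0)%VS by rewrite capvC.
have [[_ idI] _ leastI] := sqI.
(* Simplicity provides some ideal [I1] generated by squares; leastness identifies it with [I]. *)
have {I1 sqI1} minI J : ideal br J -> [\/ J = 0%VS, J = I | J = fullv].
  suff -> : I = I1 by apply: minI.
  have [idI1 sqmI1 leastI1] := sqI1; have [idI' sqmI _] := sqI.
  by apply/eqP; rewrite eqEsubv leastI // leastI1.
have [[closedG _ _] _ _] := simpleG.
pose pG := daddv_pi G I; pose pI := daddv_pi I G.
have pGI x : pG x + pI x = x by rewrite daddv_pi_add // GI_full memvf.
have pG_mem x : pG x \in G by apply: memv_pi.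
have pI_mem x : pI x \in I by apply: memv_pi.
have pG_id x : x \in G -> pG x = x by apply: daddv_pi_id.
have pI_id x : x \in I -> pI x = x by apply: daddv_pi_id.
have pG_I x : x \in I -> pG x = 0.
  by move=> /pI_id pIx; apply: (addIr x); rewrite -{2}pIx pGI add0r.
have pI_G x : x \in G -> pI x = 0.
  by move=> /pG_id pGx; apply: (addrI x); rewrite -{1}pGx pGI addr0.
have [a Ga Da] : exists2 a, a \in G &
    forall x, x \in G -> (pG \o d)%VF x = br x a.
  apply: (simple_lie_derivation_inner charF leibL simpleG) => [x _|x y Gx Gy].
    by rewrite comp_lfunE.
  (* Of the [I]-components of [d x] and [d y], the second contributes zero as [L, I] = 0, the first
     a bracket in [I], which [pG] kills. *)
  rewrite !comp_lfunE derd linearD /= -{1}(pGI (d x)) -{1}(pGI (d y)).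
  rewrite linearDl linearDr /= !linearD /=.
  rewrite (br_squares_ideal_eq0 leibL sqI x (pI_mem (d y))) linear0 addr0.
  have [Ixy _] := idI (pI (d x)) y (pI_mem _) (memvf y).
  by rewrite (pG_I _ Ixy) addr0 !(pG_id (br _ _)) ?closedG.
pose h := d - rmul br a.
have hE x : h x = d x - br x a by rewrite add_lfunE opp_lfunE rmulE.
have derh : derivation br h.
  move=> x y; rewrite !hE derd -(rmulE br a (br x y)).
  rewrite (derivation_rmul leibL) !rmulE.
  by rewrite linearBl linearBr /= opprD addrACA.
have h_I x : x \in I -> h x \in I by apply: (derivation_squares_ideal sqI).
have h_G x : x \in G -> h x \in I.
  move=> Gx; rewrite hE -(Da x Gx) comp_lfunE -{1}(pGI (d x)) addrC addKr.
  exact: pI_mem.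
exists a, (h \o pI)%VF, (h \o pG)%VF.
(* The [I]-component of [x, y] is [pI x, pG y]. Applying the derivation [h] leaves [h (pI x), pG y],
   since h(G) lies in [I] and [L, I] = 0. *)
have alphaE x y : (h \o pI)%VF (br x y) = br ((h \o pI)%VF x) y.
  rewrite !comp_lfunE -{1}(pGI x) -{1}(pGI y) linearDl !linearDr /=.
  rewrite !(br_squares_ideal_eq0 leibL sqI _ (pI_mem y)) !addr0.
  have [Ixy _] := idI (pI x) (pG y) (pI_mem _) (memvf _).
  rewrite linearD /= (pI_G _ (closedG _ _ _ _)) // add0r (pI_id _ Ixy) derh.
  rewrite (br_squares_ideal_eq0 leibL sqI _ (h_G _ (pG_mem y))) addr0.
  rewrite -{2}(pGI y) linearDr /=.
  by rewrite (br_squares_ideal_eq0 leibL sqI _ (pI_mem y)) addr0.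
have alphaI : ((h \o pI)%VF @: I <= I)%VS.
  by apply/subvP => _ /memv_imgP[x _ ->]; rewrite comp_lfunE h_I.
split=> //.
- by split=> // x Gx; rewrite comp_lfunE pI_G ?linear0.
- split=> [|x Ix]; last by rewrite comp_lfunE pG_I ?linear0.
  by apply/subvP => _ /memv_imgP[x _ ->]; rewrite comp_lfunE h_G.
- apply/lfunP => x; rewrite 2!add_lfunE !comp_lfunE -addrA -linearD /=.
  by rewrite [pI x + _]addrC pGI hE rmulE addrC subrK.
(* The image of [I] is closed under right products by [alphaE], and left products with it vanish. If
   it is all of L it contains [I], so it again equals [I]. *)
split=> //; have [||-> | alpha_full] := minI ((h \o pI)%VF @: I)%VS.
- split=> [|_ y /memv_imgP[x Ix ->] _]; first exact: subvf.
  have [Ixy _] := idI x y Ix (memvf y).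
  rewrite -alphaE memv_img //.
  by rewrite (br_squares_ideal_eq0 leibL sqI) ?mem0v // comp_lfunE h_I.
- move=> alpha0; left; apply/lfunP => x; rewrite [RHS]lfunE /=.
  have : (h \o pI)%VF (pI x) \in ((h \o pI)%VF @: I)%VS by rewrite memv_img.
  by rewrite alpha0 memv0 !comp_lfunE (pI_id (pI x)) // => /eqP.
- by right.
by right; apply/eqP; rewrite eqEsubv alphaI alpha_full subvf.
Qed.
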